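(* Let $G$ be an edge-colored graph with $\delta^c(G)\ge 5$. Then $G$ has a $(2,2)$-feasible partition, i.e. $V(G)$ can be partitioned into two non-empty sets $A$ and $B$ such that $\delta^c(G[A])\ge 2$ and $\delta^c(G[B])\ge 2$.
   Context: All graphs are finite and simple, and have non-empty vertex set. An edge-colored graph is a graph together with an arbitrary (not necessarily proper) assignment of a color to each edge. For a vertex $v$ of an edge-colored graph $G$, the color degree $d^c_G(v)$ is the number of distinct colors appearing on the edges of $G$ incident with $v$, and $\delta^c(G)=\min\{d^c_G(v): v\in V(G)\}$. $G[A]$ is the subgraph induced by $A$ with the inherited edge-coloring. *)

(* Defs.v *)
From mathcomp Require Import all_boot.
Set Implicit Arguments.
Unset Strict Implicit.
Unset Printing Implicit Defensive.

(* Only the colors of adjacent pairs are meaningful: [color u v] is an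
   irrelevant junk value when [u] and [v] are not adjacent, and no later
   definition looks at it. Non-emptiness of the vertex set is not part of the
   record, so that [induced A] is defined for every [A]. *)
Record ecgraph (C : eqType) := ECGraph {
  vertex :> finType;
  adj : rel vertex;
  adj_sym : symmetric adj;
  adj_irr : irreflexive adj;
  color : vertex -> vertex -> C;
  color_sym : forall u v, adj u v -> color u v = color v u }.

Section ColorDegree.
Variables (C : eqType) (G : ecgraph C).

Definition color_degree (v : G) : nat :=
  size (undup [seq color v w | w <- enum G & adj v w]).

(* Every color degree is at most #|G|, so this unit does not affect the minimum
   when G is non-empty (see [min_color_degreeP]); it is 0 when G is empty. *)
Definition min_color_degree : nat :=
  \big[minn/#|G|]_(v : G) color_degree v.

Lemma color_degree_le_card (v : G) : color_degree v <= #|G|.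
Proof.
by rewrite (leq_trans (size_undup _)) // size_map cardE size_filter count_size.
Qed.

Lemma min_color_degree_le (v : G) : min_color_degree <= color_degree v.
Proof.
have : v \in index_enum G by rewrite mem_index_enum.
rewrite /min_color_degree; elim: (index_enum G) => // w s IH.
rewrite inE big_cons => /orP[/eqP <-|/IH]; first exact: geq_minl.
by apply: leq_trans; apply: geq_minr.
Qed.

Lemma min_color_degreeP : 0 < #|G| ->
  (forall v, min_color_degree <= color_degree v) /\
  (exists v, min_color_degree = color_degree v).
Proof.
case/card_gt0P=> v0 _; split; first exact: min_color_degree_le.
have [[v ->]|E] : (exists v, min_color_degree = color_degree v) \/
    min_color_degree = #|G|.
- rewrite /min_color_degree; elim/big_rec: _ => [|v m _ IH]; first by right.
  case: (leqP (color_degree v) m) => _; last exact: IH.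
  by left; exists v.
- by exists v.
- exists v0; apply/eqP; rewrite eqn_leq min_color_degree_le E.
  exact: color_degree_le_card.
Qed.

Variable A : {set G}.

Let induced_vertex : finType := {x : G | x \in A}.
Let induced_adj : rel induced_vertex := fun u v => adj (val u) (val v).
Let induced_color (u v : induced_vertex) : C := color (val u) (val v).

Fact induced_adj_sym : symmetric induced_adj.
Proof. by move=> u v; apply: adj_sym. Qed.

Fact induced_adj_irr : irreflexive induced_adj.
Proof. by move=> u; apply: adj_irr. Qed.

Fact induced_color_sym u v :
  induced_adj u v -> induced_color u v = induced_color v u.
Proof. exact: color_sym. Qed.

Definition induced : ecgraph C :=
  ECGraph induced_adj_sym induced_adj_irr induced_color_sym.

End ColorDegree.

Definition feasible_partition (C : eqType) (G : ecgraph C) (s t : nat)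
    (A B : {set G}) : Prop :=
  [/\ A != set0 /\ B != set0,
      A :|: B = [set: G],
      [disjoint A & B],
      s <= min_color_degree (induced A)
    & t <= min_color_degree (induced B)].

(* Main.v *)
Require Import Defs.
From mathcomp Require Import all_boot.
Set Implicit Arguments.
Unset Strict Implicit.
Unset Printing Implicit Defensive.

(** Call a non-empty vertex set rich if each of its vertices sees at least two
    colors inside it. Two disjoint rich sets suffice: enlarge one of them to a
    rich set A that is maximal among those avoiding the other; a vertex outside
    both sees at most one color in A, hence at least four outside A
    ([rich_partition]).

    To find two disjoint rich sets, the global edge-coloring is relaxed: every
    vertex assigns hues to its own incident edges, and the two ends of an edge
    need not agree. This costs nothing and makes room for vertex contractions
    and local recolorings. Take a counterexample with the fewest vertices and
    then the fewest edges, and say that uv is sole at u, in symbols u -> v, when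
    no other edge at u has its hue at u. By minimality every edge is sole at one
    of its ends at least. The following facts hold.

    - The complement of a rich set, unless it is empty, contains a vertex with
      at least four hues on its edges to the rich set. So rich sets have at
      least four vertices; in particular no triangle is rich ([outside_rich],
      [rich_gt3]).
    - If x -> y, then x may be contracted into y, and a rich set of the
      contracted graph can be pulled back by adding x if necessary. By
      minimality some vertex must lose a hue, so either there is w with w -> x
      and w -> y, or y -> x and every neighbor of x is a neighbor of y
      ([contraction]).
    - No edge is sole at both ends ([no_digon]). If xy were, x and y would be
      twins to which every common neighbor w gives the same hue, as the triangle
      xyw is not rich. Then x and y can be deleted: only the set W of vertices
      that use one hue for exactly x and y suffers. If W has at least two
      members, joining them to each other repairs them, and x and y restore a
      hue to one rich set each. A single member of W is repaired by splitting
      another of its hue classes; when all of these are singletons, it turns out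
      to have too few neighbors.
    - Hence x -> y always yields w with w -> x and w -> y, and w and x have the
      same hue at y since the triangle wxy is not rich. Therefore the
      in-neighbors of y of any given hue form a set in which everyone has an
      in-neighbor. A minimal set of this kind is rich, so two such sets meet;
      thus all arcs into a vertex have one hue at that vertex ([minset_rich],
      [same_in_hue]).

    Now let C be a smallest non-empty set in which everyone has an in-neighbor,
    and let b be a vertex outside C with at least four hues towards C, so that b
    has arcs to at least three vertices of C. An arc from C to b would give
    shortcuts through b and a smaller set of the same kind. So C is disjoint
    from the set of in-neighbors of b, which is again of this kind: a
    contradiction ([minimal_counterexample_absurd]). *)

(** * Local colorings *)

Lemma disjoints_U1 (T : finType) (x : T) (A B : {set T}) :
  [disjoint x |: A & B] = (x \notin B) && [disjoint A & B].
Proof. by rewrite -!setI_eq0 setIUl setU_eq0 !setI_eq0 disjoints1. Qed.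

Section LocalColorings.
Variables T K : finType.
Implicit Types (V S A : {set T}) (e : rel T) (c : T -> T -> K).

Definition hues e c S v : {set K} := [set c v u | u in S & e v u].

Definition rich e c S :=
  S != set0 /\ forall v, v \in S -> 1 < #|hues e c S v|.

Definition two_rich e c :=
  exists S1 S2, [/\ [disjoint S1 & S2], rich e c S1 & rich e c S2].

Definition five_hued V e c :=
  [/\ symmetric e, irreflexive e, V != set0,
      forall u v, e u v -> u \in V
    & forall v, v \in V -> 5 <= #|hues e c V v|].

Lemma mem_hues e c S v u : u \in S -> e v u -> c v u \in hues e c S v.
Proof. by move=> uS evu; apply/imsetP; exists u; rewrite ?inE ?uS. Qed.

Lemma huesP e c S v k :
  reflect (exists u, [/\ u \in S, e v u & k = c v u]) (k \in hues e c S v).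
Proof.
apply: (iffP imsetP) => [[u]|[u [uS evu ->]]].
  by rewrite inE => /andP[uS evu] ->; exists u.
by exists u; rewrite ?inE ?uS.
Qed.

(** Whenever the graph is modified, surviving hues are tracked by this
    comparison, in which the edge that witnesses a hue may change. *)
Lemma leq_hues e c S e' c' S' v :
  (forall u, u \in S -> e v u ->
     exists u', [/\ u' \in S', e' v u' & c' v u' = c v u]) ->
  #|hues e c S v| <= #|hues e' c' S' v|.
Proof.
move=> sub; apply/subset_leq_card/subsetP => k /huesP[u [uS evu ->]].
by have [u' [u'S evu' <-]] := sub u uS evu; apply: mem_hues.
Qed.

Lemma two_hues e c S v u u' :
    u \in S -> u' \in S -> e v u -> e v u' -> c v u != c v u' ->
  1 < #|hues e c S v|.
Proof.
move=> uS u'S evu evu' ne; apply/card_gt1P; exists (c v u), (c v u').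
by split=> //; apply: mem_hues.
Qed.

Lemma two_huesP e c S v : 1 < #|hues e c S v| ->
  exists u u', [/\ u \in S, u' \in S, e v u, e v u' & c v u != c v u'].
Proof.
case/card_gt1P=> k [k'] [/huesP[u [uS evu ->]] /huesP[u' [u'S evu' ->]] ne].
by exists u, u'.
Qed.

Lemma hues_cover e c S S1 S2 v : S \subset S1 :|: S2 ->
  #|hues e c S v| <= #|hues e c S1 v| + #|hues e c S2 v|.
Proof.
move=> /subsetP sub; apply: leq_trans (leq_card_setU _ _).
apply/subset_leq_card/subsetP => k /huesP[u [/sub]].
by rewrite !inE => /orP[] uS evu ->; apply/orP; [left|right]; apply: mem_hues.
Qed.

Lemma card_hues e c S v : #|hues e c S v| <= #|S|.
Proof.
apply: leq_trans (leq_imset_card _ _) _; apply: subset_leq_card.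
by apply/subsetP=> u; rewrite inE => /andP[].
Qed.

Lemma five_hued_sub V e c S : five_hued V e c -> rich e c S -> S \subset V.
Proof.
case=> _ _ _ eV _ [_ rS]; apply/subsetP => v /rS/two_huesP[u [_ [_ _ evu _ _]]].
exact: eV evu.
Qed.

(** The arc from [u] to [v]: a walk that enters [u] by another edge and leaves
    along this one always changes hue at [u]. *)
Definition sole e c u v :=
  e u v && [forall w, e u w && (c u w == c u v) ==> (w == v)].

Lemma soleP e c u v :
  reflect (e u v /\ forall w, e u w -> c u w = c u v -> w = v) (sole e c u v).
Proof.
apply: (iffP andP) => [[euv /forallP uni]|[euv uni]]; split=> //.
  by move=> w euw eqc; apply/eqP/(implyP (uni w)); rewrite euw eqc eqxx.
by apply/forallP=> w; apply/implyP=> /andP[euw /eqP eqc]; apply/eqP/uni.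
Qed.

Lemma sole_edge e c u v : sole e c u v -> e u v.
Proof. by case/soleP. Qed.

Lemma sole_neq e c u v w :
  sole e c u v -> e u w -> w != v -> c u w != c u v.
Proof.
by case/soleP=> _ uni euw; apply: contraNneq => eqc; rewrite (uni w).
Qed.

Lemma not_sole e c u v : e u v -> ~~ sole e c u v ->
  exists w, [/\ e u w, c u w = c u v & w != v].
Proof.
rewrite /sole => -> /=; rewrite negb_forall => /existsP[w].
by rewrite negb_imply => /andP[/andP[euw /eqP eqc] wv]; exists w.
Qed.

(** This is what minimality under the deletion of edges gives: an edge that
    satisfies neither alternative can be deleted, for an end at which it is not
    sole loses no hue, and an end with six hues can spare one. *)
Definition minimal_edges V e c := forall u v, e u v ->
  (sole e c u v /\ #|hues e c V u| <= 5) \/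
  (sole e c v u /\ #|hues e c V v| <= 5).

Lemma minimal_subrel V e c : five_hued V e c ->
  exists e', [/\ subrel e' e, five_hued V e' c & minimal_edges V e' c].
Proof.
have [m] := ubnP #|[set p | e p.1 p.2]|.
elim: m e => // m IH e; rewrite ltnS => le_em five.
have [esym eirr V0 eV deg] := five.
pose crit u v := sole e c u v && (#|hues e c V u| <= 5).
have [/'forall_forallP/= all_crit|] :=
  boolP [forall u, forall v, e u v ==> (crit u v || crit v u)].
  exists e; split=> // u v /(implyP (all_crit u v)).
  by case/orP=> /andP[]; [left|right].
rewrite negb_forall => /existsP[x]; rewrite negb_forall => /existsP[y].
rewrite negb_imply negb_or => /andP[exy /andP[ncxy ncyx]].
pose e' u v := e u v && ~~ ((u == x) && (v == y) || (u == y) && (v == x)).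
have e'e : subrel e' e by move=> u v /andP[].
have five' : five_hued V e' c.
  have keep u v : e u v -> ~~ crit u v ->
      (forall w, e u w -> w != v -> e' u w) -> 5 <= #|hues e' c V u|.
    move=> euv; rewrite negb_and => /orP[ns|le5] sub; last first.
      rewrite -ltnS; move: le5; rewrite -ltnNge => /leq_trans -> //.
      apply: leq_trans (_ : _ <= #|c u v |: hues e' c V u|) _.
        apply/subset_leq_card/subsetP=> k /huesP[w [wV euw ->]].
        rewrite !inE; have [->|wv] := eqVneq w v; first by rewrite eqxx.
        by rewrite mem_hues ?orbT // sub.
      by rewrite cardsU1; case: (_ \notin _); rewrite ?leqnSn.
    apply: leq_trans (deg u (eV _ _ euv)) (leq_hues _) => w wV euw.
    have [->|wv] := eqVneq w v; last by exists w; rewrite sub.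
    have [w' [euw' <- w'v]] := not_sole euv ns.
    by exists w'; rewrite sub // (eV w' u) // esym.
  have nxy : x != y by apply: contraTneq exy => ->; rewrite eirr.
  split=> //.
  - by move=> u v; rewrite /e' esym orbC; congr (_ && ~~ (_ || _)); exact: andbC.
  - by move=> u; rewrite /e' eirr.
  - by move=> u v /e'e/eV.
  - move=> v vV; have [->|vx] := eqVneq v x.
      apply: (keep x y) => // w exw wy.
      by rewrite /e' exw (negPf wy) (negPf nxy) !andbF.
    have [->|vy] := eqVneq v y.
      apply: (keep y x); rewrite // 1?esym // => w eyw wx.
      by rewrite /e' eyw (negPf wx) eq_sym (negPf nxy) !andbF.
    apply: leq_trans (deg v vV) (leq_hues _) => w wV evw.
    by exists w; rewrite /e' evw (negPf vx) (negPf vy).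
have lt_em : #|[set p | e' p.1 p.2]| < m.
  apply: leq_trans le_em; apply: proper_card; apply/properP; split.
    by apply/subsetP=> p; rewrite !inE => /e'e.
  by exists (x, y); rewrite !inE /e' ?exy //= !eqxx.
have [e'' [sub five'' min'']] := IH e' lt_em five'.
by exists e''; split=> // u v /sub/e'e.
Qed.

Definition richb e c S := (S != set0) && [forall v in S, 1 < #|hues e c S v|].

Lemma richP e c S : reflect (rich e c S) (richb e c S).
Proof.
by apply: (iffP andP) => -[S0 /forall_inP rS]; split=> //; apply/forall_inP.
Qed.

Lemma two_rich_dec e c : {two_rich e c} + {~ two_rich e c}.
Proof.
apply: (@decP _ [exists S1 : {set T}, exists S2 : {set T},
  [&& [disjoint S1 & S2], richb e c S1 & richb e c S2]]).
apply: (iffP existsP) => -[S1].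
  by case/existsP=> S2 /and3P[S12 /richP r1 /richP r2]; exists S1, S2.
case=> S2 [S12 /richP r1 /richP r2]; exists S1; apply/existsP; exists S2.
exact/and3P.
Qed.

Lemma rich_subrel e e' c S : subrel e' e -> rich e' c S -> rich e c S.
Proof.
move=> sub [S0 rS]; split=> // v vS; apply: leq_trans (rS v vS) (leq_hues _).
by move=> u uS /sub evu; exists u.
Qed.

End LocalColorings.

(** * Minimal counterexamples: small rich sets and contraction *)

Section MinimalCounterexample.
Variables (T K : finType) (V : {set T}) (e : rel T) (c : T -> T -> K).
Hypothesis five : five_hued V e c.
Hypothesis minimal : minimal_edges V e c.
Hypothesis smaller : forall (V' : {set T}) (e' : rel T) (c' : T -> T -> K),
  #|V'| < #|V| -> five_hued V' e' c' -> two_rich e' c'.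
Hypothesis not_two_rich : ~ two_rich e c.

Let esym : symmetric e. Proof. by case: five. Qed.
Let eirr : irreflexive e. Proof. by case: five. Qed.
Let eV u v : e u v -> u \in V. Proof. by case: five => _ _ _ eV _; apply: eV. Qed.
Let eVr u v : e u v -> v \in V. Proof. by rewrite esym; apply: eV. Qed.
Let deg v : v \in V -> 5 <= #|hues e c V v|.
Proof. by case: five => _ _ _ _ deg; apply: deg. Qed.
Let edge_neq u v : e u v -> u != v.
Proof. by apply: contraTneq => ->; rewrite eirr. Qed.

(** Five hues cannot be spread over at most one outside [A] and at most three
    in [A]; so if no such vertex existed, the complement would be rich too. *)
Lemma outside_rich A : rich e c A -> V :\: A != set0 ->
  exists b, [/\ b \in V, b \notin A & 4 <= #|hues e c A b|].
Proof.
move=> rA VA0.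
have [/exists_inP[b]|] := boolP [exists b in V :\: A, 4 <= #|hues e c A b|].
  by rewrite inE => /andP[bA bV] b4; exists b.
rewrite negb_exists_in => /forall_inP few; case: not_two_rich.
exists A, (V :\: A); split=> //; first by rewrite disjoints_subset setCD subsetUr.
split=> // v vVA; have := few v vVA; rewrite -ltnNge ltnS => le3.
have := vVA; rewrite inE => /andP[vA vV].
have : 5 <= 3 + #|hues e c (V :\: A) v|; last by rewrite (leq_add2l 3 2).
apply: leq_trans (deg vV) _.
apply: leq_trans (leq_add le3 (leqnn _)); apply: hues_cover.
by apply/subsetP=> u uV; rewrite !inE uV andbT orbN.
Qed.

(** The vertex that [outside_rich] provides has four neighbors in [A]. *)
Lemma rich_gt3 A : rich e c A -> 3 < #|A|.
Proof.
move=> rA; rewrite ltnNge; apply/negP=> A3.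
have [|b [_ _ b4]] := outside_rich rA; last first.
  by have := leq_trans b4 (leq_trans (card_hues _ _ _ _) A3).
rewrite setD_eq0; apply: contraTN A3 => VA; rewrite -ltnNge.
have [/set0Pn[a /(subsetP (five_hued_sub five rA)) aV] _] := rA.
apply: leq_trans (subset_leq_card VA).
by apply: leq_trans (leq_trans (deg aV) (card_hues _ _ _ _)).
Qed.

Lemma no_rich_triangle u v w : e u v -> e u w -> e v w ->
  c u v != c u w -> c v u != c v w -> c w u != c w v -> False.
Proof.
move=> euv euw evw nu nv nw; have [evu ewu ewv] : [/\ e v u, e w u & e w v].
  by split; rewrite esym.
have /rich_gt3 : rich e c [set u; v; w].
  split=> [|z]; first by apply/set0Pn; exists u; rewrite !inE eqxx.
  rewrite !inE => /orP[/orP[]|] /eqP->.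
  - by apply: (@two_hues _ _ _ _ _ _ v w); rewrite // !inE eqxx ?orbT.
  - by apply: (@two_hues _ _ _ _ _ _ u w); rewrite // !inE eqxx ?orbT.
  - by apply: (@two_hues _ _ _ _ _ _ u v); rewrite // !inE eqxx ?orbT.
rewrite ltnNge; case/negP; apply: leq_trans (leq_card_setU _ _) _.
by rewrite cards1 addn1 cards2; case: (u != v).
Qed.

Section Contraction.
Variables x y : T.
Hypothesis sxy : sole e c x y.

Let exy : e x y. Proof. exact: sole_edge sxy. Qed.
Let eyx : e y x. Proof. by rewrite esym. Qed.
Let xy : x != y. Proof. exact: edge_neq. Qed.
Let yx : y != x. Proof. by rewrite eq_sym. Qed.

Definition contracted_edge u w := [&& u != x, w != x &
  [|| e u w, [&& u == y, w != y & e x w] | [&& w == y, u != y & e x u]]].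

(** A common neighbor [u] of [x] and [y] keeps only one edge, with the hue
    of [x] exactly when that hue would be lost otherwise. At [y] the
    edges inherited from [x] get the hue of [x], so that [x] can stand in for
    them. *)
Definition contracted_hue u w :=
  if w == y then if e u y && ~~ sole e c u x then c u y else c u x
  else if (u == y) && ~~ e y w then c y x else c u w.

Let e' := contracted_edge.
Let c' := contracted_hue.

Lemma five_hued_contracted :
    (forall w, sole e c w x -> ~ sole e c w y) ->
    ~~ (sole e c y x && [forall w, e x w && (w != y) ==> e y w]) ->
  five_hued (V :\ x) e' c'.
Proof.
move=> no_w escape; split.
- move=> u w; rewrite /e' /contracted_edge esym andbCA.
  by congr [&& _, _ & _ || _]; exact: orbC.
- by move=> u; rewrite /e' /contracted_edge eirr; case: (u == y); rewrite !andbF.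
- by apply/set0Pn; exists y; rewrite !inE yx (eV eyx).
- move=> u w /and3P[ux _ /or3P[euw|/and3P[/eqP-> _ _]|/and3P[_ _]]].
  + by rewrite !inE ux (eV euw).
  + by rewrite !inE yx (eV eyx).
  + by move/eVr=> uV; rewrite !inE ux.
move=> v; rewrite !inE => /andP[vx vV].
apply: leq_trans (deg vV) (leq_hues _) => u uV evu.
have [vy|vy] := eqVneq v y.
  subst v; have [ux|ux] := eqVneq u x; last first.
    exists u; rewrite /e' /contracted_edge /c' /contracted_hue.
    by rewrite !inE ux uV yx evu (eq_sym u) (negPf (edge_neq evu)) ?andbF.
  (* The hue of x at y survives on another edge of y or on an edge from x to
     a vertex that is not adjacent to y. *)
  subst u; move: escape; rewrite negb_and => /orP[/(not_sole eyx)|].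
    case=> w [eyw eqc wx]; exists w.
    rewrite /e' /contracted_edge /c' /contracted_hue !inE wx (eVr eyw) eyw yx.
    by rewrite eq_sym (negPf (edge_neq eyw)) andbF.
  rewrite negb_forall => /existsP[w]; rewrite negb_imply.
  case/andP=> /andP[exw wy] neyw; have wx := edge_neq exw.
  exists w; rewrite /e' /contracted_edge /c' /contracted_hue.
  rewrite !inE (eVr exw) (eq_sym w) wx yx ?eqxx wy.
  by rewrite exw (negPf neyw) (negPf wy) orbT.
have keep w : e v w -> w != x -> w != y ->
    exists w', [/\ w' \in V :\ x, e' v w' & c' v w' = c v w].
  move=> evw wx wy; exists w; rewrite /e' /contracted_edge /c' /contracted_hue.
  by rewrite !inE wx (eVr evw) vx evw (negPf wy) (negPf vy).
have to_y k : (if e v y && ~~ sole e c v x then c v y else c v x) = k ->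
    e v x || e v y -> exists w', [/\ w' \in V :\ x, e' v w' & c' v w' = k].
  move=> eqk ev; exists y; rewrite /e' /contracted_edge /c' /contracted_hue.
  rewrite !inE yx (eV eyx) vx eqxx vy (negPf vy) /=.
  by rewrite orbC (esym x v).
have [ux|ux] := eqVneq u x.
  subst u; have [svx|nsvx] := boolP (sole e c v x).
    by apply: to_y; rewrite ?svx ?andbF // evu.
  have [w [evw <- wx]] := not_sole evu nsvx.
  have [wy|wy] := eqVneq w y; last exact: keep.
  by subst w; apply: to_y; rewrite ?evw ?nsvx ?orbT.
have [uy|uy] := eqVneq u y; last exact: keep.
subst u; have [svx|nsvx] := boolP (sole e c v x); last first.
  by apply: to_y; rewrite ?evu ?nsvx ?orbT.
(* The edge vy now has the hue of x; since vy is not sole at v, its former hue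
   survives on another edge. *)
have nsvy : ~~ sole e c v y by apply/negP; apply: no_w.
have [w [evw eqc wy]] := not_sole evu nsvy.
rewrite -eqc; apply: keep => //; apply/eqP=> wx; subst w.
by have := sole_neq svx evu; rewrite eqc eqxx yx => /(_ isT).
Qed.

Definition uses_contracted (S : {set T}) :=
  (y \in S) && [exists w in S, e x w && (w != y)].

(** When [x] is needed as a replacement for the hues inherited by [y], it has
    two neighbors in the enlarged set, one of them [y], and these give it two
    hues because [x y] is sole at [x]. *)
Lemma rich_uncontract S : rich e' c' S ->
  rich e c (if uses_contracted S then x |: S else S).
Proof.
rewrite /e' /contracted_edge /c' /contracted_hue.
case=> S0 rS; case: ifPn => [/andP[yS /exists_inP[w wS /andP[exw wy]]]|nP].
  split=> [|v]; first by apply/set0Pn; exists x; rewrite !inE eqxx.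
  rewrite !inE => /orP[/eqP->|vS].
    apply: (@two_hues _ _ _ _ _ _ w y); rewrite ?inE ?wS ?yS ?orbT //.
    exact: sole_neq sxy _ _.
  apply: leq_trans (rS v vS) (leq_hues _) => u uS /and3P[_ _].
  have [->|uy] := eqVneq u y.
    case: (boolP (e v y)) => [evy|nevy] /=.
      case: (boolP (sole e c v x)) => [/sole_edge evx|_] _.
        by exists x; rewrite !inE eqxx.
      by exists y; rewrite !inE yS orbT.
    rewrite andbF => /andP[_ exv]; exists x.
    by rewrite !inE eqxx esym.
  have [->|vy] := eqVneq v y; last first.
    by rewrite orbF => evu; exists u; rewrite !inE uS orbT.
  case: (boolP (e y u)) => [eyu|neyu] _; last by exists x; rewrite !inE eqxx.
  by exists u; rewrite !inE uS orbT.
split=> // v vS; apply: leq_trans (rS v vS) (leq_hues _).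
move=> u uS /and3P[_ _ evu].
have noS a b : a \in S -> b \in S -> a == y -> b != y -> e x b = false.
  move=> aS bS /eqP ay bY; apply/negP=> exb; case/negP: nP.
  by rewrite /uses_contracted -{1}ay aS; apply/exists_inP; exists b; rewrite ?exb.
exists u; rewrite uS; move: evu; have [uy|uy] := eqVneq u y.
  subst u; have [vy|vy] := eqVneq v y; first by subst v; rewrite eirr.
  have nexv : e x v = false by apply: noS uS vS _ _.
  rewrite nexv orbF /= => ->.
  by rewrite ifT //; apply/negP=> /sole_edge; rewrite esym nexv.
have [vy|vy] := eqVneq v y; last by rewrite orbF.
by subst v; rewrite (noS _ _ vS uS) // orbF => eyu; rewrite eyu.
Qed.

(** Contracting [x] into [y] leaves a smaller counterexample unless a vertex
    loses a hue: a common neighbor at which both edges are sole, or [y] itself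
    when it inherits no edge from [x]. *)
Lemma contraction : (forall w, sole e c w x -> ~ sole e c w y) ->
  sole e c y x /\ forall w, e x w -> w != y -> e y w.
Proof.
move=> no_w; have [syx_sub|escape] :=
  boolP (sole e c y x && [forall w, e x w && (w != y) ==> e y w]).
  case/andP: syx_sub => -> /forallP sub; split=> // w exw wy.
  by apply: (implyP (sub w)); rewrite exw.
have five' := five_hued_contracted no_w escape.
have [S1 [S2 [S12 r1 r2]]] : two_rich e' c'.
  apply: smaller five'; apply: proper_card; apply: properD1; exact: eV exy.
have xS S : rich e' c' S -> x \notin S.
  move/(five_hued_sub five')/subsetP=> sub.
  by apply/negP=> /sub; rewrite !inE eqxx.
pose lift S := if uses_contracted S then x |: S else S.
case: not_two_rich; exists (lift S1), (lift S2).
split; [|exact: rich_uncontract|exact: rich_uncontract].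
have [x1 x2] := (xS _ r1, xS _ r2).
(* Only one of the two sets contains y, hence only one of them receives x. *)
have : ~~ (uses_contracted S1 && uses_contracted S2).
  apply/negP=> /andP[/andP[y1 _] /andP[y2 _]].
  by rewrite (disjointFr S12 y1) in y2.
rewrite /lift; case: (uses_contracted S1) (uses_contracted S2) => [] [] // _.
  by rewrite disjoints_U1 x2.
by rewrite disjoint_sym disjoints_U1 x1 disjoint_sym.
Qed.

End Contraction.

(** * Edges that are sole at both ends *)

(** By contraction both ends have the same other neighbors, and a neighbor that
    distinguished them would form a rich triangle with them. *)
Lemma digon_nbrs x y : sole e c x y -> sole e c y x ->
  forall w, e x w -> w != y -> e y w /\ c w x = c w y.
Proof.
move=> sxy syx w exw wy; have [exy eyx] := (sole_edge sxy, sole_edge syx).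
have eyw : e y w.
  apply: (contraction sxy _).2 => // t stx sty.
  have [etx ety] := (sole_edge stx, sole_edge sty).
  have [tx ty] := (edge_neq etx, edge_neq ety).
  apply: (@no_rich_triangle t x y) => //.
  - by rewrite eq_sym (sole_neq stx) // eq_sym edge_neq.
  - by rewrite (sole_neq sxy) // esym.
  - by rewrite (sole_neq syx) // esym.
split=> //; apply/eqP/negPn/negP=> nw.
apply: (@no_rich_triangle x y w) => //.
- by rewrite eq_sym (sole_neq sxy).
- by rewrite eq_sym (sole_neq syx) // eq_sym edge_neq.
Qed.

(** At [w] the edge to [x] is not sole, so minimality puts the burden on [x]. *)
Lemma digon_tight x y w : sole e c x y -> sole e c y x ->
  e x w -> w != y -> sole e c x w /\ #|hues e c V x| <= 5.
Proof.
move=> sxy syx exw wy; have [eyw eqc] := digon_nbrs sxy syx exw wy.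
case: (minimal exw) => // -[swx _].
have yx : y != x by rewrite eq_sym (edge_neq (sole_edge sxy)).
have ewy : e w y by rewrite esym.
by have := sole_neq swx ewy yx; rewrite eqc eqxx.
Qed.

Lemma digon_sole x y : sole e c x y -> sole e c y x ->
  forall w, e x w -> sole e c x w.
Proof.
move=> sxy syx w exw; have [->//|wy] := eqVneq w y.
by have [] := digon_tight sxy syx exw wy.
Qed.

Lemma digon_other x y : sole e c x y -> exists2 w, e x w & w != y.
Proof.
move/sole_edge=> exy; have := leq_trans (isT : 1 < 5) (deg (eV exy)).
case/two_huesP=> u [w [_ _ exu exw ne]].
have [uy|uy] := eqVneq u y; last by exists u.
by exists w => //; apply: contraNneq ne => ->; rewrite uy.
Qed.

(** All edges at [x] are sole, so there are as many neighbors as hues. *)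
Lemma digon_card x y : sole e c x y -> sole e c y x ->
  #|[set w | e x w]| <= 5.
Proof.
move=> sxy syx; have [w exw wy] := digon_other sxy.
have [_ le5] := digon_tight sxy syx exw wy.
apply: leq_trans le5; rewrite /hues.
rewrite (_ : [set u in V | e x u] = [set w | e x w]); last first.
  by apply/setP=> u; rewrite !inE; case exu: (e x u); rewrite ?andbF ?(eVr exu).
rewrite card_in_imset // => u v; rewrite !inE => exu exv eqc.
by have /soleP[_] := digon_sole sxy syx exv; apply.
Qed.

Section TwinDeletion.
Variables x y : T.
Hypotheses (sxy : sole e c x y) (syx : sole e c y x).

Let exy : e x y. Proof. exact: sole_edge sxy. Qed.
Let eyx : e y x. Proof. exact: sole_edge syx. Qed.
Let xy : x != y. Proof. exact: edge_neq. Qed.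

Definition rest := V :\ x :\ y.

(** These are the vertices that lose a hue when [x] and [y] are deleted. *)
Definition losers := [set w in rest | e w x &
  [forall u, e w u && (c w u == c w x) ==> ((u == x) || (u == y))]].

Lemma mem_rest v : (v \in rest) = [&& v != y, v != x & v \in V].
Proof. by rewrite !inE. Qed.

Lemma notin_rest u : u \in V -> u \notin rest -> (u == x) || (u == y).
Proof. by move=> uV; rewrite mem_rest uV andbT -negb_or negbK orbC. Qed.

Lemma rest_in v : v \in rest -> v \in V.
Proof. by rewrite mem_rest => /and3P[]. Qed.

Lemma card_rest : #|rest| < #|V|.
Proof.
apply: leq_ltn_trans (subset_leq_card (subD1set _ _)) _.
by rewrite [ltnRHS](cardsD1 x) (eV exy).
Qed.

Lemma rest_neq0 : rest != set0.
Proof.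
have [w exw wy] := digon_other sxy.
by apply/set0Pn; exists w; rewrite mem_rest wy (eVr exw) eq_sym edge_neq.
Qed.

Lemma twin_nbr v u : v \in rest -> e v u -> (u == x) || (u == y) ->
  [/\ e v x, e v y, c v x = c v y & c v u = c v x].
Proof.
rewrite mem_rest => /and3P[vy vx _]; rewrite !(esym v).
move=> euv /orP[/eqP ux|/eqP uy]; subst u.
  by have [eyv ->] := digon_nbrs sxy syx euv vy.
by have [exv ->] := digon_nbrs syx sxy euv vx.
Qed.

Lemma losersP w : w \in losers ->
  [/\ w \in rest, e w x, e w y, c w x = c w y
    & forall u, u \in rest -> e w u -> c w u != c w x].
Proof.
rewrite /losers inE => /and3P[wR ewx /forallP allw].
have [|_ ewy eqc _] := twin_nbr wR ewx; first by rewrite eqxx.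
split=> // u; rewrite mem_rest => /and3P[uy ux _] ewu.
by apply: contraL (allw u) => eqcu; rewrite ewu eqcu (negPf uy) (negPf ux).
Qed.

Lemma keep_hue v u : v \in rest -> v \notin losers -> e v u ->
  exists u', [/\ u' \in rest, e v u' & c v u' = c v u].
Proof.
move=> vR vL evu; have [uR|uR] := boolP (u \in rest); first by exists u.
have [evx evy _ ->] := twin_nbr vR evu (notin_rest (eVr evu) uR).
move: vL; rewrite /losers inE vR evx /= negb_forall => /existsP[u'].
rewrite negb_imply negb_or => /andP[/andP[evu' /eqP eqc] /andP[u'x u'y]].
by exists u'; rewrite mem_rest u'x u'y (eVr evu').
Qed.

(** A single loser [w] regains its hue by splitting the class of [a] and [b]: the
    edge to [a] gets the hue that the twins had. A rich set that
    exploits the split contains [w], and adding both twins to it makes up for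
    merging the class again. *)
Lemma single_loser_split w a b : losers = [set w] ->
  a \in rest -> b \in rest -> e w a -> e w b -> a != b -> c w a != c w b.
Proof.
move=> eqL aR bR ewa ewb ab; apply/eqP=> eqab.
have [|wR ewx ewy eqc nex] := @losersP w; first by rewrite eqL inE.
have [exw eyw] : e x w /\ e y w by split; rewrite esym.
pose e' v u := [&& v \in rest, u \in rest & e v u].
pose c' v u := if (v == w) && (u == a) then c w x else c v u.
have five' : five_hued rest e' c'.
  split; first by move=> v u; rewrite /e' esym andbCA.
  - by move=> v; rewrite /e' eirr !andbF.
  - exact: rest_neq0.
  - by move=> v u /and3P[].
  move=> v vR; apply: leq_trans (deg (rest_in vR)) (leq_hues _) => u uV evu.
  have [vw|vw] := eqVneq v w; last first.
    have vL : v \notin losers by rewrite eqL inE.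
    have [u' [u'R evu' eqc']] := keep_hue vR vL evu.
    by exists u'; rewrite u'R /e' vR u'R evu' /c' (negPf vw).
  subst v; have [uR|uR] := boolP (u \in rest); last first.
    exists a; rewrite aR /e' wR aR ewa /c' !eqxx; split=> //.
    by have [_ _ _ ->] := twin_nbr wR evu (notin_rest uV uR).
  have [->|ua] := eqVneq u a.
    exists b; rewrite bR /e' wR bR ewb /c' (eq_sym b) (negPf ab) andbF.
    by split.
  by exists u; rewrite uR /e' wR uR evu /c' (negPf ua) andbF.
have [S1 [S2 [S12 r1 r2]]] := smaller card_rest five'.
have sub S : rich e' c' S -> {subset S <= rest}.
  by move/(five_hued_sub five')/subsetP.
pose lift (S : {set T}) := if w \in S then x |: (y |: S) else S.
have rich_lift S : rich e' c' S -> rich e c (lift S).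
  case=> S0 rS.
  have other v : v \in S -> v != w -> 1 < #|hues e c S v|.
    move=> vS vw; apply: leq_trans (rS v vS) (leq_hues _).
    by move=> u uS /and3P[_ _ evu]; exists u; rewrite /c' (negPf vw).
  rewrite /lift; case: ifPn => wS; last first.
    by split=> // v vS; apply: other => //; apply: contraNneq wS => <-.
  have := wR; rewrite mem_rest => /and3P[wy wx _].
  split=> [|v]; first by apply/set0Pn; exists x; rewrite !inE eqxx.
  rewrite !inE => /or3P[/eqP->|/eqP->|vS].
  - apply: (@two_hues _ _ _ _ _ _ w y); rewrite ?inE ?wS ?eqxx ?orbT //.
    exact: sole_neq sxy _ _.
  - apply: (@two_hues _ _ _ _ _ _ w x); rewrite ?inE ?wS ?eqxx ?orbT //.
    exact: sole_neq syx _ _.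
  have [->|vw] := eqVneq v w; last first.
    apply: leq_trans (other v vS vw) (leq_hues _) => u uS evu.
    by exists u; rewrite !inE uS !orbT.
  have [u [_ [uS _ /and3P[_ uR ewu] _ _]]] := two_huesP (rS w wS).
  apply: (@two_hues _ _ _ _ _ _ u x); rewrite ?inE ?uS ?eqxx ?orbT //.
  exact: nex.
case: not_two_rich; exists (lift S1), (lift S2).
split; [|exact: rich_lift|exact: rich_lift].
have xyS S : rich e' c' S -> (x \notin S) && (y \notin S).
  move/sub=> SR; apply/andP; split; apply/negP=> /SR; rewrite mem_rest eqxx //.
  by rewrite andbF.
have /andP[x1 y1] := xyS _ r1; have /andP[x2 y2] := xyS _ r2.
rewrite /lift; case: ifPn => wS1.
  by rewrite (disjointFr S12 wS1) !disjoints_U1 x2 y2.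
case: ifPn => // wS2.
by rewrite disjoint_sym !disjoints_U1 x1 y1 disjoint_sym.
Qed.

(** Otherwise all edges from [w] to the rest are sole at [w]. Contracting them
    shows that their other ends are neighbors of [x]. As [x] has at most five
    neighbors, among them [w], and [w] does not distinguish [x] from [y], at most
    four hues occur at [w]. *)
Lemma not_single_loser w : losers <> [set w].
Proof.
move=> eqL; have [|wR ewx ewy eqc nex] := @losersP w; first by rewrite eqL inE.
have sw u : u \in rest -> e w u -> sole e c w u.
  move=> uR ewu; apply/soleP; split=> // u' ewu' eqcu.
  have [u'R|u'R] := boolP (u' \in rest).
    by apply/eqP; apply: contraPT eqcu => u'u; apply/eqP/single_loser_split.
  have [_ _ _ eqcx] := twin_nbr wR ewu' (notin_rest (eVr ewu') u'R).
  by have := nex u uR ewu; rewrite -eqcu eqcx eqxx.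
(* The edge wx is not sole at w, whereas all edges at an end of an edge that is
   sole at both ends are. *)
have nsw u : sole e c w u -> ~ sole e c u w.
  move=> swu suw; have /soleP[_ uni] := digon_sole swu suw ewx.
  by move: xy; rewrite (uni y) ?eqxx.
have exu u : u \in rest -> e w u -> e x u.
  move=> uR ewu; have [//|nexu] := boolP (e x u).
  case: (nsw u (sw u uR ewu)); apply: (contraction (sw u uR ewu) _).1.
  move=> t stw stu; have [etw etu] := (sole_edge stw, sole_edge stu).
  have ewt : e w t by rewrite esym.
  have [tR|tR] := boolP (t \in rest); first exact: nsw (sw t tR ewt) stw.
  have eut : e u t by rewrite esym.
  have [eux _ _ _] := twin_nbr uR eut (notin_rest (eVr eut) tR).
  by rewrite esym eux in nexu.
have wV : w \in V := eV ewx.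
have exw : e x w by rewrite esym.
have := digon_card sxy syx.
rewrite (cardsD1 w) inE exw ltnNge => /negP; apply.
apply: leq_trans (deg wV) _; apply: leq_trans (leq_imset_card (c w) _).
apply/subset_leq_card/subsetP=> k /huesP[u [uV ewu ->]].
have [uR|uR] := boolP (u \in rest).
  by apply: imset_f; rewrite !inE exu // eq_sym edge_neq.
have [_ _ _ ->] := twin_nbr wR ewu (notin_rest uV uR).
by rewrite eqc; apply: imset_f; rewrite !inE exy edge_neq // esym.
Qed.

(** Adjacent losers would form a rich triangle with [x]. *)
Lemma losers_indep v u : v \in losers -> u \in losers -> ~ e v u.
Proof.
case/losersP=> vR evx _ _ nev /losersP[uR eux _ _ neu] evu.
have euv : e u v by rewrite esym.
apply: (@no_rich_triangle x v u); rewrite // 1?esym // 1?(eq_sym (c _ x)).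
- rewrite (sole_neq (digon_sole sxy syx _)) 1?esym //.
  exact: edge_neq.
- exact: nev.
- exact: neu.
Qed.

(** When losers are joined to each other, a rich set with two of them regains in
    [x] or in [y] the hue that the new edges provided. *)
Lemma losers_joined : #|losers| != 1 -> False.
Proof.
move=> L1.
pose e' v u := [&& v \in rest, u \in rest &
  e v u || [&& v \in losers, u \in losers & u != v]].
pose c' v u := if (v \in losers) && (u \in losers) then c v x else c v u.
have five' : five_hued rest e' c'.
  split.
  - move=> v u; rewrite /e' esym andbCA (eq_sym v).
    by rewrite (andbCA (v \in losers)).
  - by move=> v; rewrite /e' eirr eqxx !andbF.
  - exact: rest_neq0.
  - by move=> v u /and3P[].
  move=> v vR; apply: leq_trans (deg (rest_in vR)) (leq_hues _) => u uV evu.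
  have [vL|vL] := boolP (v \in losers); last first.
    have [u' [u'R evu' eqc']] := keep_hue vR vL evu.
    by exists u'; rewrite u'R /e' vR u'R evu' /c' (negPf vL).
  have [uR|uR] := boolP (u \in rest).
    have uL : u \notin losers by apply/negP=> /(losers_indep vL).
    by exists u; rewrite uR /e' vR uR evu /c' (negPf uL) andbF.
  have [_ _ _ ->] := twin_nbr vR evu (notin_rest uV uR).
  have [u' u'L u'v] : exists2 u', u' \in losers & u' != v.
    have : 0 < #|losers :\ v| by move: L1; rewrite (cardsD1 v) vL; case: #|_|.
    by case/card_gt0P=> u' /setD1P[u'v u'L]; exists u'.
  have [u'R _ _ _ _] := losersP u'L.
  by exists u'; rewrite u'R /e' vR u'R vL u'L u'v orbT /c' vL u'L.
have sub S : rich e' c' S -> {subset S <= rest}.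
  by move/(five_hued_sub five')/subsetP.
pose lift z (S : {set T}) := if 1 < #|S :&: losers| then z |: S else S.
have rich_lift z S : (z == x) || (z == y) -> rich e' c' S -> rich e c (lift z S).
  move=> zxy [S0 rS].
  have zL v : v \in losers -> [/\ e v z, sole e c z v & c v z = c v x].
    case/losersP=> _ evx evy eqc _; case/orP: zxy => /eqP->; split=> //.
      by apply: (digon_sole sxy syx); rewrite esym.
    by apply: (digon_sole syx sxy); rewrite esym.
  rewrite /lift; case: ifPn => SL.
    split=> [|v]; first by apply/set0Pn; exists z; rewrite !inE eqxx.
    rewrite in_setU1 => /orP[/eqP->|vS].
      case/card_gt1P: SL => a [b [/setIP[aS aL] /setIP[bS bL] ab]].
      have [[_ /sole_edge eza _] [_ szb _]] := (zL a aL, zL b bL).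
      apply: (@two_hues _ _ _ _ _ _ a b); rewrite ?inE ?aS ?bS ?orbT //.
        exact: sole_edge szb.
      exact: sole_neq szb _ _.
    apply: leq_trans (rS v vS) (leq_hues _) => u uS /and3P[_ _].
    rewrite /c' andbA.
    case: (boolP ((v \in losers) && (u \in losers))) => [/andP[vL _] _|_].
      by have [evz _ eqc] := zL v vL; exists z; rewrite setU11.
    by rewrite orbF => evu; exists u; rewrite !inE uS orbT.
  split=> // v vS; apply: leq_trans (rS v vS) (leq_hues _) => u uS /and3P[_ _].
  rewrite /c' andbA.
  case: (boolP ((v \in losers) && (u \in losers))) => [/andP[vL uL]|_].
    case/orP=> [/(losers_indep vL uL)//|uv]; case/negP: SL.
    by apply/card_gt1P; exists u, v; split=> //; apply/setIP.
  by rewrite orbF => evu; exists u.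
have [S1 [S2 [S12 r1 r2]]] := smaller card_rest five'.
case: not_two_rich; exists (lift x S1), (lift y S2).
split; try by apply: rich_lift; rewrite ?eqxx ?orbT.
have x2 : x \notin S2 by apply/negP=> /(sub _ r2); rewrite mem_rest eqxx andbF.
have y1 : y \notin S1 by apply/negP=> /(sub _ r1); rewrite mem_rest eqxx.
rewrite /lift; case: ifP => _; case: ifP => _ //.
- rewrite disjoints_U1 in_setU1 negb_or xy x2 disjoint_sym disjoints_U1 y1.
  by rewrite disjoint_sym.
- by rewrite disjoints_U1 x2.
- by rewrite disjoint_sym disjoints_U1 y1 disjoint_sym.
Qed.

End TwinDeletion.

Lemma no_digon x y : sole e c x y -> ~ sole e c y x.
Proof.
move=> sxy syx; apply: (losers_joined sxy syx).
by apply/negP=> /cards1P[w]; apply: not_single_loser sxy syx w.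
Qed.

(** * Sets in which everyone has an in-neighbor *)

Lemma edge_sole u v : e u v -> sole e c u v \/ sole e c v u.
Proof. by case/minimal=> -[suv _]; [left|right]. Qed.

(** Contraction yields [w], and the hues agree because the triangle [w x y] is
    not rich. *)
Lemma common_source x y : sole e c x y ->
  exists w, [/\ sole e c w x, sole e c w y & c y w = c y x].
Proof.
move=> sxy; have [/existsP[w /andP[swx swy]]|nw] :=
  boolP [exists w, sole e c w x && sole e c w y]; last first.
  case: (no_digon sxy); apply: (contraction sxy _).1 => w swx swy.
  by case/existsP: nw; exists w; rewrite swx.
exists w; split=> //; apply/eqP/negPn/negP=> ne.
have [[ewx ewy] exy] := (sole_edge swx, sole_edge swy, sole_edge sxy).
apply: (@no_rich_triangle w x y) => //.
- by rewrite eq_sym (sole_neq swx) // eq_sym edge_neq.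
- by rewrite (sole_neq sxy) ?edge_neq // esym.
Qed.

Definition in_closed (S : {set T}) :=
  (S != set0) && [forall v in S, exists u in S, sole e c u v].

Lemma in_closedP S :
  reflect (S != set0 /\
           exists f, forall v, v \in S -> f v \in S /\ sole e c (f v) v)
          (in_closed S).
Proof.
apply: (iffP andP) => -[S0 clS]; split=> //.
  exists (fun v => odflt v [pick u in S | sole e c u v]) => v vS.
  case: pickP => [u /andP[] //|no].
  have /exists_inP[u uS suv] := forall_inP clS v vS.
  by have := no u; rewrite uS suv.
case: clS => f clS; apply/forall_inP => v /clS[fvS sv].
by apply/exists_inP; exists (f v).
Qed.

Lemma in_closed_image S (f : T -> T) : S != set0 ->
    (forall v, v \in S -> f v \in S /\ sole e c (f v) v) ->
  in_closed (f @: S).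
Proof.
case/set0Pn=> v0 v0S clS; apply/in_closedP; split.
  by apply/set0Pn; exists (f v0); apply: imset_f.
exists f => v /imsetP[u /clS[fuS _] ->].
by have [_ sff] := clS _ fuS; rewrite imset_f.
Qed.

(** The image of [S] under [f] is in-closed as well, hence not smaller. *)
Lemma minset_image S (f : T -> T) : minset in_closed S ->
    (forall v, v \in S -> f v \in S /\ sole e c (f v) v) ->
  f @: S = S.
Proof.
case/minsetP=> /andP[S0 _] minS clS; apply: minS; first exact: in_closed_image.
by apply/subsetP=> _ /imsetP[v /clS[fvS _] ->].
Qed.

(** A map that selects in-neighbors is onto by minimality, so each vertex has an
    in-neighbor and an out-neighbor, and they are distinct by [no_digon]. *)
Lemma minset_rich S : minset in_closed S -> rich e c S.
Proof.
move=> minS; have /minsetP[/in_closedP[S0 [f clS]] _] := minS.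
have imS := minset_image minS clS; split=> // v vS.
have [fvS sfv] := clS v vS; have efv := sole_edge sfv.
have /imsetP[w wS eqv] : v \in f @: S by rewrite imS.
have svw : sole e c v w by have [_] := clS w wS; rewrite -eqv.
have evw := sole_edge svw; have evf : e v (f v) by rewrite esym.
apply: (two_hues fvS wS evf evw); apply: (sole_neq svw evf).
by apply/eqP=> fw; rewrite fw in sfv; apply: no_digon svw sfv.
Qed.

Lemma in_closed_meet S1 S2 :
  in_closed S1 -> in_closed S2 -> ~~ [disjoint S1 & S2].
Proof.
case/minset_exists=> A1 /minset_rich rA1 A1S.
case/minset_exists=> A2 /minset_rich rA2 A2S.
apply/negP=> S12; case: not_two_rich; exists A1, A2; split=> //.
exact: disjointW S12.
Qed.

(** By [common_source] the in-neighbors of [v] of one hue form an in-closed set,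
    and those of different hues are disjoint. *)
Lemma same_in_hue u u' v : sole e c u v -> sole e c u' v -> c v u = c v u'.
Proof.
move=> suv su'v; apply/eqP/negPn/negP=> ne.
pose Q w := [set a | sole e c a v & c v a == c v w].
have clQ w : sole e c w v -> in_closed (Q w).
  move=> swv; apply/andP; split.
    by apply/set0Pn; exists w; rewrite inE swv eqxx.
  apply/forall_inP=> a; rewrite inE => /andP[sav /eqP eqa].
  have [b [sba sbv eqb]] := common_source sav.
  by apply/exists_inP; exists b; rewrite // inE sbv eqb eqa eqxx.
have /pred0Pn[a] := in_closed_meet (clQ u suv) (clQ u' su'v).
rewrite !inE => /andP[/andP[_ /eqP eqa] /andP[_ /eqP eqa']].
by case/eqP: ne; rewrite -eqa.
Qed.

Lemma sources_in_closed x y : sole e c x y -> in_closed [set a | sole e c a y].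
Proof.
move=> sxy; apply/andP; split; first by apply/set0Pn; exists x; rewrite inE.
apply/forall_inP=> a; rewrite inE => say.
have [b [sba sby _]] := common_source say.
by apply/exists_inP; exists b; rewrite ?inE.
Qed.

(** By [same_in_hue] the arcs from [C] to [b] contribute at most one hue. *)
Lemma hues_leq_targets C b : #|hues e c C b| <=
  #|[set u in C | sole e c b u]| + [exists u in C, sole e c u b].
Proof.
set O := [set u in C | _].
have [/exists_inP[u0 u0C su0]|none] := boolP [exists u in C, sole e c u b].
  apply: leq_trans (_ : #|c b u0 |: c b @: O| <= _).
    apply/subset_leq_card/subsetP=> k /huesP[u [uC ebu ->]]; rewrite !inE.
    case: (edge_sole ebu) => [sbu|sub].
      by apply/orP; right; apply: imset_f; rewrite inE uC.
    by rewrite (same_in_hue sub su0) eqxx.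
  rewrite cardsU1 addnC leq_add ?leq_imset_card //.
  by case: (_ \notin _).
rewrite addn0; apply: leq_trans (leq_imset_card (c b) O).
apply/subset_leq_card/subsetP=> k /huesP[u [uC ebu ->]].
apply: imset_f; rewrite inE uC; case: (edge_sole ebu) => // sub.
by case/exists_inP: none; exists u.
Qed.

(** A smallest in-closed set [C] is disjoint from the in-neighbors of a vertex
    [b] with four hues towards [C], which form an in-closed set as well. *)
Lemma minimal_counterexample_absurd : False.
Proof.
have [I [clI I_lt]] : exists I, in_closed I /\ #|I| < #|V|.
  have [_ _ /set0Pn[v vV] _ _] := five.
  have /two_huesP[u [_ [_ _ evu _ _]]] := leq_trans (isT : 1 < 5) (deg vV).
  have [x [y sxy]] : exists x y, sole e c x y.
    by case: (edge_sole evu) => ?; [exists v, u|exists u, v].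
  exists [set a | sole e c a y]; split; first exact: sources_in_closed sxy.
  apply: proper_card; apply/properP; split.
    by apply/subsetP=> a; rewrite inE => /sole_edge/eV.
  exists y; first exact: eVr (sole_edge sxy).
  by rewrite inE; apply/negP=> /sole_edge; rewrite eirr.
case: (arg_minnP (fun S : {set T} => #|S|) clI) => C clC minC.
have minsetC : minset in_closed C.
  apply/minsetP; split=> // S clS SC; apply/eqP.
  by rewrite eqEcard SC minC.
have C_lt : #|C| < #|V| := leq_ltn_trans (minC _ clI) I_lt.
have VC0 : V :\: C != set0.
  by rewrite setD_eq0; apply: contraTN C_lt => /subset_leq_card; rewrite -leqNgt.
have [b [bV bC b4]] := outside_rich (minset_rich minsetC) VC0.
have := leq_trans b4 (hues_leq_targets C b).
set O := [set u in C | _].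
have [/exists_inP[a aC sab]|none] := boolP [exists u in C, sole e c u b].
  rewrite addn1 ltnS => O3.
  have /in_closedP[C0 [f clf]] := clC.
  have imf := minset_image minsetC clf.
  have injf : {in C &, injective f} by apply/imset_injP; rewrite imf.
  (* Reroute the selected in-neighbors through b: the vertices that only served
     the at least three targets of b become superfluous, except possibly a. *)
  pose g v := if v == b then a else if v \in O then b else f v.
  have OC : O \subset C by apply/subsetP=> u; rewrite inE => /andP[].
  have clg : in_closed (g @: (b |: C)).
    apply: in_closed_image => [|v].
      by apply/set0Pn; exists b; rewrite setU11.
    rewrite in_setU1 /g; have [-> _|_ /= vC] := eqVneq v b.
      by rewrite in_setU1 aC orbT.
    case: ifP => [|_]; first by rewrite inE => /andP[_ sbv]; rewrite setU11.
    by have [fvC sfv] := clf v vC; rewrite in_setU1 fvC orbT.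
  have sub : g @: (b |: C) \subset (b |: C) :\: (f @: O :\ a).
    apply/subsetP=> _ /imsetP[v vbC ->]; rewrite inE.
    have gbC : g v \in b |: C.
      move: vbC; rewrite !in_setU1 /g; have [_ _|_ /= vC] := eqVneq v b.
        by rewrite aC orbT.
      by case: ifP => _; rewrite ?eqxx // (clf v vC).1 orbT.
    rewrite gbC andbT in_setD1 negb_and negbK.
    move: vbC; rewrite in_setU1 /g; have [_ _|_ /= vC] := eqVneq v b.
      by rewrite eqxx.
    case: ifP => [_|vO]; apply/orP; right; apply/imsetP=> -[w wO eqw].
      by case/negP: bC; rewrite eqw (clf w (subsetP OC w wO)).1.
    by rewrite (injf _ _ vC (subsetP OC w wO) eqw) wO in vO.
  have := leq_trans (minC _ clg) (subset_leq_card sub).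
  rewrite cardsD (setIidPr _); last first.
    apply/subsetP=> _ /setD1P[_ /imsetP[v vO ->]].
    by rewrite in_setU1 (clf v (subsetP OC v vO)).1 orbT.
  rewrite cardsU1 bC add1n.
  have : 2 <= #|f @: O :\ a|.
    move: O3; rewrite -(card_in_imset (sub_in2 (subsetP OC) injf)).
    by rewrite (cardsD1 a); case: (a \in _) => // /ltnW.
  case: #|_ :\ _| => [|[|n]] // _; rewrite !subSS.
  move=> le; have C1 : 0 < #|C| by rewrite card_gt0.
  by move: le; rewrite leqNgt ltn_subrL ltnS C1.
rewrite addn0 => O4; have /card_gt0P[u] : 0 < #|O| by apply: leq_trans O4.
rewrite inE => /andP[_ sbu]; have [w [swb _ _]] := common_source sbu.
have /pred0Pn[z /=] := in_closed_meet clC (sources_in_closed swb).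
by rewrite inE => /andP[zC szb]; case/exists_inP: none; exists z.
Qed.

End MinimalCounterexample.

(** * Two disjoint rich sets and the partition *)

Section Existence.
Variables T K : finType.
Implicit Types (V S A : {set T}) (e : rel T) (c : T -> T -> K).

(** Deleting edges creates no rich set, so edge-minimality may be imposed on top
    of induction on the number of vertices. *)
Lemma five_hued_two_rich V e c : five_hued V e c -> two_rich e c.
Proof.
have [m] := ubnP #|V|; elim: m V e c => // m IH V e c; rewrite ltnS => Vm five.
have [e' [sub five' min']] := minimal_subrel five.
have [[S1 [S2 [S12 r1 r2]]]|no] := two_rich_dec e' c.
  by exists S1, S2; split=> //; apply: rich_subrel sub _.
case: (minimal_counterexample_absurd five' min' _ no) => V' e2 c2 lt.
by apply: IH; apply: leq_trans lt Vm.
Qed.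

(** The first of two disjoint rich sets is enlarged as long as it stays rich and
    disjoint from the second; what remains is then rich too. *)
Lemma rich_partition e c : five_hued [set: T] e c ->
  exists A, rich e c A /\ rich e c (~: A).
Proof.
move=> five; have [S1 [S2 [S12 r1 r2]]] := five_hued_two_rich five.
pose P A := richb e c A && [disjoint A & S2].
have PS1 : P S1 by rewrite /P S12 andbT; apply/richP.
have [A /maxsetP[/andP[/richP rA AS2] maxA] _] := maxset_exists PS1.
have S2A : S2 \subset ~: A by rewrite -disjoints_subset disjoint_sym.
exists A; split=> //; case: r2 => S20 r2; split.
  by apply: contraNneq S20 => A'0; move: S2A; rewrite A'0 subset0.
move=> v; rewrite inE => vA; have [vS2|vS2] := boolP (v \in S2).
  apply: leq_trans (r2 v vS2) (leq_hues _) => u uS2 evu.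
  by exists u; rewrite (subsetP S2A).
have [_ _ _ _ deg] := five; have deg5 := deg v (in_setT v).
have hA : #|hues e c A v| <= 1.
  rewrite leqNgt; apply: contra vA => h2.
  rewrite -(maxA (v |: A)) ?setU11 ?subsetUr //; apply/andP; split.
    apply/richP; split=> [|w wvA]; first by apply/set0Pn; exists v; rewrite setU11.
    have : 1 < #|hues e c A w|.
      by move: wvA; rewrite in_setU1 => /orP[/eqP->|/(rA.2 w)].
    move/leq_trans; apply; apply: leq_hues => u uA ewu.
    by exists u; rewrite in_setU1 uA orbT.
  by rewrite disjoints_U1 vS2.
have : 5 <= 1 + #|hues e c (~: A) v|; last by move/ltnW/ltnW.
apply: leq_trans (leq_add hA (leqnn _)); apply: leq_trans deg5 _.
by apply: hues_cover; rewrite setUCr.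
Qed.

End Existence.

(** * Back to edge-colored graphs *)

Section EdgeColoredGraphs.
Variables (C : eqType) (G : ecgraph C).

(** Hues must range over a finite type, unlike the colors of [G]. *)
Definition palette : seq C := [seq color p.1 p.2 | p <- enum {: G * G}].
Definition hue (v u : G) : 'I_(size palette).+1 :=
  inord (index (color v u) palette).

Lemma hue_inj (v u v' u' : G) : hue v u = hue v' u' -> color v u = color v' u'.
Proof.
have inP (a b : G) : color a b \in palette.
  by apply/mapP; exists (a, b); rewrite ?mem_enum.
move/(congr1 val); rewrite /= !inordK ?ltnS ?index_size // => eq_index.
by rewrite -(nth_index (color v u) (inP v u)) eq_index nth_index.
Qed.

Lemma color_degree_hues (v : G) :
  color_degree v <= #|hues (@adj _ G) hue [set: G] v|.
Proof.
rewrite /color_degree; set s := [seq _ | w <- _ & _].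
pose h k : 'I_(size palette).+1 := inord (index k palette).
rewrite -(size_map h) cardE; apply: uniq_leq_size.
  rewrite map_inj_in_uniq ?undup_uniq // => k k'; rewrite !mem_undup.
  by case/mapP=> w _ -> /mapP[w' _ ->] /hue_inj.
move=> _ /mapP[k + ->]; rewrite mem_undup mem_enum => /mapP[w + ->].
by rewrite mem_filter => /andP[vw _]; apply: (mem_hues hue (in_setT w)).
Qed.

Lemma rich_induced (A : {set G}) :
  rich (@adj _ G) hue A -> 2 <= min_color_degree (induced A).
Proof.
case=> /set0Pn[a aA] rA.
have A_gt0 : 0 < #|induced A| by apply/card_gt0P; exists (exist _ a aA).
have [_ [[v vA] ->]] := min_color_degreeP A_gt0.
have [u [u' [uA u'A evu evu' ne]]] := two_huesP (rA v vA).
pose w : induced A := exist _ u uA; pose w' : induced A := exist _ u' u'A.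
apply: (@uniq_leq_size _ [:: color v u; color v u']) => [|k].
  by rewrite /= inE andbT; apply: contraNneq ne => eqc; rewrite /hue eqc.
rewrite mem_undup !inE => /orP[] /eqP->; apply/mapP; [exists w|exists w'] => //.
  by rewrite mem_filter mem_enum andbT.
by rewrite mem_filter mem_enum andbT.
Qed.

End EdgeColoredGraphs.

Theorem theorem1p1 (C : eqType) (G : ecgraph C) (G_nonempty : 0 < #|G|)
    (G_deg : 5 <= min_color_degree G) :
  exists A B : {set G}, feasible_partition 2 2 A B.
Proof.
have /card_gt0P[v0 _] := G_nonempty.
have five : five_hued [set: G] (@adj _ G) (@hue _ G).
  split=> //; [exact: adj_sym|exact: adj_irr|by apply/set0Pn; exists v0|].
  move=> v _; apply: leq_trans (color_degree_hues v).
  exact: leq_trans G_deg (min_color_degree_le v).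
have [A [rA rB]] := rich_partition five; exists A, (~: A); split.
- by case: rA rB => A0 _ [B0 _].
- exact: setUCr.
- by rewrite disjoints_subset setCK.
- exact: rich_induced.
- exact: rich_induced.
Qed.
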